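(* Let $\mathcal{F}=\{A_i=x_iy_i^*: i=1,2,\ldots,m\}\subset\mathbb{C}^{n\times n}$ be an irreducible family of rank-one matrices (with $x_i,y_i\in\mathbb{C}^n$ nonzero). Then $\mathcal{F}$ has the finiteness property, and every spectral maximizing product $A_{i_1}A_{i_2}\cdots A_{i_t}$ of $\mathcal{F}$ of minimal length $t$ has distinct factors, i.e. $i_s\neq i_r$ whenever $s\neq r$.
   Context: For a finite set $\mathcal{F}=\{A_1,\ldots,A_m\}$ of $m$ (distinct) complex $n\times n$ matrices and $k\ge 1$, let $\mathcal{F}_k=\{A_{i_1}A_{i_2}\cdots A_{i_k}: 1\le i_j\le m\}$ be the set of all products of length $k$. The joint (equivalently, generalized) spectral radius of $\mathcal{F}$ is $\rho(\mathcal{F})=\lim_{k\to\infty}\max_{A\in\mathcal{F}_k}\|A\|^{1/k}=\limsup_{k\to\infty}\max_{A\in\mathcal{F}_k}\rho(A)^{1/k}$, where $\|\cdot\|$ is any sub-multiplicative matrix norm and $\rho(A)$ is the spectral radius of a matrix $A$ (the two expressions are known to coincide for finite sets). The family $\mathcal{F}$ is irreducible if the matrices in $\mathcal{F}$ have no common non-trivial invariant linear subspace of $\mathbb{C}^n$ (i.e. none other than $\{0\}$ and $\mathbb{C}^n$). The family $\mathcal{F}$ has the finiteness property if there are a positive integer $t$ and a product $A_{i_1}A_{i_2}\cdots A_{i_t}\in\mathcal{F}_t$ with $\rho(\mathcal{F})=\rho(A_{i_1}A_{i_2}\cdots A_{i_t})^{1/t}$; such a product (sequence) is called a spectral maximizing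 product (sequence) of length $t$. The symbol $y^*$ denotes the conjugate transpose of $y$. *)

(* Defs.v *)
From HB Require Import structures.
From mathcomp Require Import all_boot all_order all_algebra.
From mathcomp Require Import sesquilinear spectral.
From mathcomp Require Import all_classical all_reals all_analysis.
From mathcomp Require Import complex.

Set Implicit Arguments.
Unset Strict Implicit.
Unset Printing Implicit Defensive.

Import Order.TTheory GRing.Theory Num.Theory.
Import numFieldNormedType.Exports.

Local Open Scope classical_set_scope.
Local Open Scope ring_scope.

(* The library norm on R[i] takes its values in R[i]; [Normc.normc] is the
   same modulus, with values in R. *)
Record submult_norm (R : realType) (n : nat) (N : 'M[R[i]]_n -> R) : Prop :=
  SubmultNorm {
    submult_norm0_eq0 : forall A, N A = 0 -> A = 0;
    submult_normD : forall A B, N (A + B) <= N A + N B;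
    submult_normZ : forall (c : R[i]) A, N (c *: A) = Normc.normc c * N A;
    submult_normM : forall A B, N (A *m B) <= N A * N B
  }.

(* For n > 0 the spectrum is finite and nonempty, so the supremum is a maximum.
   [eigenvalue] refers to row eigenvectors, which gives the same spectrum. *)
Definition spectral_radius (R : realType) (n : nat) (A : 'M[R[i]]_n) : R :=
  sup [set Normc.normc a | a in [set a | eigenvalue A a]].

Section Family.
Variables (R : realType) (n m : nat).
Implicit Types (N : 'M[R[i]]_n -> R) (A : 'I_m -> 'M[R[i]]_n).

Definition word_prod A (w : seq 'I_m) : 'M[R[i]]_n :=
  \big[mulmx/1%:M]_(i <- w) A i.

Definition products A (k : nat) : seq 'M[R[i]]_n :=
  [seq word_prod A w | w : k.-tuple 'I_m].

(* The default value 0 of the maximum is harmless, as the terms are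
   nonnegative; only the terms with k > 0 matter for the limit. For m > 0 and
   a submultiplicative norm N the limit exists and does not depend on N. *)
Definition joint_spectral_radius N A : R :=
  limn (fun k : nat => \big[Num.max/0]_(B <- products A k) (N B `^ k%:R^-1)).

Definition irreducible_family A : Prop :=
  forall U : {vspace 'cV[R[i]]_n},
    (forall i (u : 'cV[R[i]]_n), u \in U -> A i *m u \in U) ->
    U = 0%VS \/ U = fullv.

Definition spectral_maximizing N A (t : nat) (w : t.-tuple 'I_m) : Prop :=
  (0 < t)%N /\
  joint_spectral_radius N A = spectral_radius (word_prod A w) `^ t%:R^-1.

Definition finiteness_property N A : Prop :=
  exists (t : nat) (w : t.-tuple 'I_m), spectral_maximizing N A w.

Definition minimal_spectral_maximizing N A (t : nat) (w : t.-tuple 'I_m) : Prop :=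
  spectral_maximizing N A w /\
  forall (t' : nat) (w' : t'.-tuple 'I_m),
    spectral_maximizing N A w' -> (t <= t')%N.

End Family.

(* Main.v *)
Require Import Defs.
(* The product along a word i_1 ... i_k is the path weight
   prod_s (y_(i_s)^* x_(i_(s+1))) times x_(i_1) y_(i_k)^*, so its spectral radius
   is the modulus of the cyclic weight of the word. Cutting a word at a repeated
   letter removes a closed factor and multiplies cyclic weights; hence the
   maximum r of (cyclic weight)^(1/length) over words with distinct letters
   bounds all words, and path weights are O(s^k) for every s > r. Therefore r is
   the joint spectral radius, it is attained, and a maximizing word with a
   repeated letter has a shorter maximizing factor. *)
From HB Require Import structures.
From mathcomp Require Import all_boot all_order all_algebra.
From mathcomp Require Import sesquilinear spectral.
From mathcomp Require Import all_classical all_reals all_analysis.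
From mathcomp Require Import complex.
From mathcomp Require Import ring lra zify.

Set Implicit Arguments.
Unset Strict Implicit.
Unset Printing Implicit Defensive.

Import Order.TTheory GRing.Theory Num.Theory.
Import numFieldNormedType.Exports.

Local Open Scope ring_scope.
Local Open Scope sesquilinear_scope.

(** * Weights of words and excision at a repeated letter *)

Section Weights.
Variables (T : eqType) (K : comNzRingType) (c : T -> T -> K).

Fixpoint path_weight (i : T) (s : seq T) : K :=
  if s is j :: s' then c i j * path_weight j s' else 1.

Definition open_weight (s : seq T) : K :=
  if s is i :: s' then path_weight i s' else 1.

(** Appending the first letter closes the walk. The empty word gets weight 1, in accordance with the
    bound [r ^+ 0]. *)
Definition closed_weight (s : seq T) : K :=
  if s is i :: s' then path_weight i (rcons s' i) else 1.

Lemma path_weight_cat i s t :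
  path_weight i (s ++ t) = path_weight i s * path_weight (last i s) t.
Proof. by elim: s i => [|j s IH] i /=; rewrite ?mul1r // IH mulrA. Qed.

(** The walk passes twice through [i]. The loop between the two visits can be cut out without
    changing any other edge, and its edges make up the closed weight of [i :: q]. *)
Lemma open_weight_split p i q u :
  open_weight (p ++ i :: q ++ i :: u)
  = closed_weight (i :: q) * open_weight (p ++ i :: u).
Proof.
have H j s : path_weight j (s ++ i :: q ++ i :: u) =
             path_weight i (rcons q i) * path_weight j (s ++ i :: u).
  rewrite !(path_weight_cat j s) /= -cat_rcons path_weight_cat last_rcons.
  by rewrite !mulrA; congr (_ * _); rewrite mulrC mulrA.
case: p => [|j p] /=; last exact: H.
by rewrite -cat_rcons path_weight_cat last_rcons.
Qed.

(** For nonempty [p] the closing letter is absorbed into the tail [u], which reduces the claim to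
    open walks. *)
Lemma closed_weight_split p i q u :
  closed_weight (p ++ i :: q ++ i :: u)
  = closed_weight (i :: q) * closed_weight (p ++ i :: u).
Proof.
case: p => [|j p] /=.
  by rewrite rcons_cat /= -cat_rcons path_weight_cat last_rcons.
have := open_weight_split (j :: p) i q (rcons u j).
by rewrite /= !rcons_cat /= !rcons_cat.
Qed.

Lemma size_split (p : seq T) i q u :
  size (p ++ i :: q ++ i :: u) = (size (i :: q) + size (p ++ i :: u))%N.
Proof. by rewrite /= !size_cat /= size_cat /= addnCA -!addSnnS. Qed.

Lemma nuniq_split (s : seq T) :
  ~~ uniq s -> exists p i q u, s = p ++ i :: q ++ i :: u.
Proof.
elim: s => //= i s IH; rewrite negb_and negbK => /orP[|/IH].
  by case/splitPr => q u; exists [::], i, q, u.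
by move=> [p [j [q [u ->]]]]; exists (i :: p), j, q, u.
Qed.

End Weights.

Lemma path_weight_morph (T : eqType) (K L : comNzRingType) (f : K -> L)
    (c : T -> T -> K) i s :
  f 1 = 1 -> {morph f : a b / a * b} ->
  f (path_weight c i s) = path_weight (fun j k => f (c j k)) i s.
Proof. by move=> f1 fM; elim: s i => [|j s IH] i //=; rewrite fM IH. Qed.

Lemma exists_ubound2 (T : finType) (R : realDomainType) (f : T -> T -> R) :
  exists2 M, 1 <= M & forall i j, f i j <= M.
Proof.
exists (\big[Num.max/1]_(p : T * T) f p.1 p.2); first exact: bigmax_ge_id.
by move=> i j; apply: (le_bigmax _ (fun p => f p.1 p.2) (i, j)).
Qed.

(** * Bounds for nonnegative weights *)

Section RealWeights.
Variables (T : finType) (R : realFieldType) (c : T -> T -> R).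
Hypothesis c_ge0 : forall i j, 0 <= c i j.

Lemma path_weight_ge0 i s : 0 <= path_weight c i s.
Proof. by elim: s i => //= j s IH i; rewrite mulr_ge0. Qed.

Lemma open_weight_ge0 s : 0 <= open_weight c s.
Proof. by case: s => //= i s; apply: path_weight_ge0. Qed.

Lemma closed_weight_ge0 s : 0 <= closed_weight c s.
Proof. by case: s => //= i s; apply: path_weight_ge0. Qed.

(** Strong induction on the length: a repeated letter splits the weight into the closed weights of
    two strictly shorter words whose lengths add up. *)
Lemma closed_weight_uniq_bound r :
  0 <= r ->
  (forall s, uniq s -> closed_weight c s <= r ^+ size s) ->
  forall s, closed_weight c s <= r ^+ size s.
Proof.
move=> r0 H s; have [n] := ubnP (size s).
elim: n s => // n IH s; rewrite ltnS => sn.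
have [/H//|/nuniq_split [p [i [q [u def_s]]]]] := boolP (uniq s).
have size_s : size s = (size (i :: q) + size (p ++ i :: u))%N.
  by rewrite def_s size_split.
rewrite size_s {1}def_s closed_weight_split exprD.
apply: ler_pM; rewrite ?closed_weight_ge0 //; apply: IH; apply: leq_trans sn.
  by rewrite size_s -[ltnLHS]addn0 ltn_add2l size_cat addnS.
by rewrite size_s -[ltnLHS]add0n ltn_add2r.
Qed.

(** Each excised loop costs at most [r] to the power of its length. What finally remains has
    distinct letters, hence length at most [#|T|], and is paid for by the constant. *)
Lemma open_weight_bound r :
  0 < r -> (forall s, closed_weight c s <= r ^+ size s) ->
  exists2 C, 0 < C & forall s, open_weight c s <= C * r ^+ size s.
Proof.
move=> r0 H.
have [M M1 cM] := exists_ubound2 c.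
have owM s : open_weight c s <= M ^+ size s.
  case: s => //= i s; rewrite exprS.
  apply: (@le_trans _ _ (M ^+ size s)); last first.
    by rewrite ler_peMl // exprn_ge0 // (le_trans ler01).
  elim: s i => //= j s IH i; rewrite exprS ler_pM //; exact: path_weight_ge0.
(* [Q] bounds the excess [M / r] per letter; being at least 1, its powers up to exponent [#|T|] are
   all at most [Q ^+ #|T|]. *)
pose Q := Num.max 1 (M / r).
have Q1 : 1 <= Q by rewrite le_max lexx.
have Q0 : 0 < Q by exact: lt_le_trans Q1.
exists (Q ^+ #|T|) => [|s]; first by rewrite exprn_gt0.
have [n] := ubnP (size s); elim: n s => // n IH s; rewrite ltnS => sn.
have [us|/nuniq_split [p [i [q [u def_s]]]]] := boolP (uniq s).
  apply: (le_trans (owM s)); rewrite -ler_pdivrMr ?exprn_gt0 // -expr_div_n.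
  apply: (@le_trans _ _ (Q ^+ size s)).
    have Mr0 : 0 <= M / r by rewrite divr_ge0 // ?(ltW r0) // (le_trans ler01).
    rewrite lerXn2r // ?nnegrE ?(ltW Q0) //.
    by rewrite /Q le_max lexx orbT.
  by rewrite ler_weXn2l // -(card_uniqP us) max_card.
have size_s : size s = (size (i :: q) + size (p ++ i :: u))%N.
  by rewrite def_s size_split.
rewrite size_s {1}def_s open_weight_split exprD mulrCA.
apply: ler_pM; rewrite ?closed_weight_ge0 ?open_weight_ge0 //; apply: IH.
by apply: leq_trans sn; rewrite size_s /= addSn ltnS leq_addl.
Qed.

End RealWeights.

(** * Roots of weights and the maximal normalised closed weight *)

Section Roots.
Local Open Scope classical_set_scope.
Local Open Scope ring_scope.
Variable R : realType.
Implicit Types a b d : R.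

Lemma powR_invnK a k : 0 <= a -> (0 < k)%N -> (a `^ k%:R^-1) ^+ k = a.
Proof.
by move=> a0 k0; rewrite -powR_mulrn ?powR_ge0 // -powRrM mulVf ?powRr1 //
  pnatr_eq0 -lt0n.
Qed.

Lemma powR_invn_le a b k :
  0 <= a -> 0 <= b -> (0 < k)%N -> (a `^ k%:R^-1 <= b) = (a <= b ^+ k).
Proof.
move=> a0 b0 k0.
by rewrite -[in RHS](powR_invnK a0 k0) ler_pXn2r ?nnegrE ?powR_ge0.
Qed.

Lemma powR_invn_eq a b k :
  0 <= a -> 0 <= b -> (0 < k)%N -> (b = a `^ k%:R^-1) <-> (a = b ^+ k).
Proof.
move=> a0 b0 k0; split=> [->|->]; first by rewrite powR_invnK.
by rewrite -powR_mulrn // -powRrM mulfV ?powRr1 // pnatr_eq0 -lt0n.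
Qed.

Lemma expr_le_near a b :
  0 <= a < 1 -> 0 < b -> \forall k \near \oo, a ^+ k <= b.
Proof.
move=> /andP[a0 a1] b0.
have a1' : `|a| < 1 by rewrite ger0_norm.
have /cvgrPdist_le/(_ _ b0) := cvg_expr a1'.
by apply: filterS => k; rewrite sub0r normrN ger0_norm // exprn_ge0.
Qed.

(** If [a < b], the powers of [a / b] tend to 0 and drop below [d / 2], whereas the hypothesis keeps
    them at least [d]. *)
Lemma expr_dominated_le a b d :
  0 <= a -> 0 < d -> (forall k, d * b ^+ k.+1 <= a ^+ k.+1) -> b <= a.
Proof.
move=> a0 d0 H; rewrite leNgt; apply/negP => ab.
have b0 : 0 < b by apply: le_lt_trans ab.
have q1 : 0 <= a / b < 1 by rewrite divr_ge0 // ?ltr_pdivrMr ?mul1r // ltW.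
have d2 : 0 < d / 2 by rewrite divr_gt0.
have [k _ /(_ k.+1 (leqnSn k)) /=] := expr_le_near q1 d2.
rewrite expr_div_n ler_pdivrMr ?exprn_gt0 // => /(le_trans (H k)).
by rewrite ler_pM2r ?exprn_gt0 // leNgt ltr_pdivrMr // ltr_pMr // ltr1n.
Qed.

(** The maximum is taken over nonempty words of length at most [#|T|], a finite type that contains
    all nonempty words with distinct letters; [closed_weight_uniq_bound] then covers every word. *)
Lemma exists_closed_weight_max (T : finType) (c : T -> T -> R) :
  (forall i j, 0 <= c i j) -> (0 < #|T|)%N ->
  exists r s, [/\ 0 <= r, (0 < size s)%N, closed_weight c s = r ^+ size s &
    forall s', closed_weight c s' <= r ^+ size s'].
Proof.
move=> c0 T0.
pose I := {k : 'I_#|T| & k.+1.-tuple T}.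
pose f (w : I) := closed_weight c (tagged w) `^ (tag w).+1%:R^-1.
have [i _] : exists i : T, true by move/card_gt0P: T0 => [i _]; exists i.
pose mkI (k : 'I_#|T|) (t : k.+1.-tuple T) : I := Tagged _ t.
pose w0 := mkI (Ordinal T0) (nseq_tuple 1 i).
have [w _ wmax] := @arg_maxP _ _ _ w0 xpredT f isT.
exists (f w), (tagged w); rewrite powR_ge0 size_tuple; split=> //.
  by rewrite powR_invnK // closed_weight_ge0.
apply: closed_weight_uniq_bound => // [|s us]; first exact: powR_ge0.
case def_s : s us => [|j s'] us; first by rewrite /= expr0.
rewrite -def_s in us *.
have ss : (size s = (size s').+1) by rewrite def_s.
have lt_s : (size s' < #|T|)%N by rewrite -ss -(card_uniqP us) max_card.
have st : size s == (Ordinal lt_s).+1 by rewrite ss.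
have := wmax (mkI _ (Tuple st)) isT.
by rewrite /f /= powR_invn_le ?closed_weight_ge0 ?powR_ge0 // ss.
Qed.

End Roots.

(** * Word products, moduli and submultiplicative norms *)

Lemma word_prod_cat (R : realType) (n m : nat) (A : 'I_m -> 'M[R[i]]_n) p q :
  word_prod A (p ++ q) = word_prod A p *m word_prod A q.
Proof.
elim: p => [|i p IH]; first by rewrite /word_prod big_nil mul1mx.
by rewrite /word_prod /= !big_cons in IH *; rewrite IH mulmxA.
Qed.

Section Normc.
Variable R : realType.
Implicit Types z : R[i].

Lemma normc_ge0 z : 0 <= Normc.normc z.
Proof. by case: z => a b; apply: sqrtr_ge0. Qed.

Lemma normcX z k : Normc.normc (z ^+ k) = Normc.normc z ^+ k.
Proof.
by elim: k => [|k IH]; rewrite ?expr0 ?Normc.normc1 // !exprS Normc.normcM IH.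
Qed.

Lemma normc_path_weight (T : eqType) (g : T -> T -> R[i]) i s :
  Normc.normc (path_weight g i s)
  = path_weight (fun j k => Normc.normc (g j k)) i s.
Proof. exact: path_weight_morph (Normc.normc1 R) (@Normc.normcM R). Qed.

End Normc.

Section Norm.
Variables (R : realType) (n : nat) (N : 'M[R[i]]_n -> R).
Hypothesis hN : submult_norm N.

Lemma submult_norm0 : N 0 = 0.
Proof. by rewrite -(scale0r 0) (submult_normZ hN) Normc.normc0 mul0r. Qed.

Lemma submult_norm_ge0 B : 0 <= N B.
Proof.
have := submult_normD hN B (-1 *: B).
rewrite (submult_normZ hN) normcN Normc.normc1 mul1r scaleN1r subrr.
by rewrite submult_norm0 -mulr2n pmulrn_lge0.
Qed.

Lemma submult_norm_gt0 B : B != 0 -> 0 < N B.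
Proof.
move=> B0; rewrite lt_def submult_norm_ge0 andbT.
by apply: contra_neq B0 => /(submult_norm0_eq0 hN).
Qed.

End Norm.

(** * Spectral radii of products of rank-one matrices, and the joint spectral radius *)

Section RankOne.
Local Open Scope classical_set_scope.
Local Open Scope ring_scope.
Variables (R : realType) (n m : nat) (N : 'M[R[i]]_n -> R).
Hypothesis hN : submult_norm N.
Variables (u : 'I_m -> 'cV[R[i]]_n) (v : 'I_m -> 'rV[R[i]]_n).
Hypotheses (u0 : forall i, u i != 0) (v0 : forall i, v i != 0).
Let A i : 'M[R[i]]_n := u i *m v i.
Let g i j : R[i] := (v i *m u j) 0 0.
Let c i j : R := Normc.normc (g i j).

Lemma mul_row_col i j : v i *m u j = (g i j)%:M.
Proof. exact: mx11_scalar. Qed.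

Lemma outer_neq0 i j : u i *m v j != 0.
Proof.
have /cV0Pn [k uk] := u0 i; have /rV0Pn [l vl] := v0 j.
apply/eqP => /matrixP/(_ k l); rewrite !mxE big_ord1 => /eqP.
by rewrite mulf_eq0 (negbTE uk) (negbTE vl).
Qed.

Lemma word_prod_rank1 i s :
  word_prod A (i :: s) = path_weight g i s *: (u i *m v (last i s)).
Proof.
rewrite /word_prod; elim: s i => [|j s IH] i.
  by rewrite big_cons big_nil mulmx1 scale1r.
rewrite big_cons IH /= -scalemxAr /A mulmxA -(mulmxA (u i)) mul_row_col.
by rewrite mul_mx_scalar -scalemxAl scalerA mulrC.
Qed.

Lemma normc_closed_weight s :
  Normc.normc (closed_weight g s) = closed_weight c s.
Proof.
by case: s => [|i s]; [exact: Normc.normc1|exact: normc_path_weight].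
Qed.

Lemma closed_weight_cons i s :
  closed_weight g (i :: s) = path_weight g i s * g (last i s) i.
Proof. by rewrite /= -cats1 path_weight_cat /= mulr1. Qed.

(** The product is a multiple of a single outer product, so its only possible eigenvalues are 0 and
    its trace, the cyclic weight; the latter has the row eigenvector [v j]. *)
Lemma spectral_radius_word s : (0 < size s)%N ->
  spectral_radius (word_prod A s) = closed_weight c s.
Proof.
case: s => // i s _; rewrite -normc_closed_weight closed_weight_cons.
rewrite word_prod_rank1; set k := path_weight _ _ _; set j := last i s.
have ev : eigenvalue (k *: (u i *m v j)) (k * g j i).
  apply/eigenvalueP; exists (v j) => //.
  by rewrite -scalemxAr mulmxA mul_row_col mul_scalar_mx scalerA.
have ev_or a : eigenvalue (k *: (u i *m v j)) a -> a = 0 \/ a = k * g j i.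
  case/eigenvalueP => z; rewrite -scalemxAr mulmxA [z *m _]mx11_scalar.
  set b := (z *m _) 0 0; rewrite mul_scalar_mx scalerA => Hz z0.
  have [->|a0] := eqVneq a 0; [by left|right].
  (* Multiplying by [u i] turns the eigenvector equation into [k * b * g j i = a * b]. Here [b]
     cancels, since [b = 0] would force [a *: z = 0]. *)
  have := congr1 (fun M => (M *m u i) 0 0) Hz.
  rewrite -!scalemxAl mul_row_col (mx11_scalar (z *m u i)) -/b.
  rewrite !mxE eqxx !mulr1n => H.
  have b0 : b != 0.
    apply: contra_neq z0 => b0; move: Hz; rewrite b0 mulr0 scale0r.
    by move/esym/eqP; rewrite scaler_eq0 (negbTE a0) => /eqP.
  apply: (mulIf b0); rewrite -H mulrAC; congr (_ * _).
rewrite /spectral_radius; set E := [set _ | _ in _].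
have inE : E (Normc.normc (k * g j i)) by exists (k * g j i).
have ubE : ubound E (Normc.normc (k * g j i)).
  move=> _ [a /ev_or [->|->] <-] //.
  by rewrite Normc.normc0 normc_ge0.
apply/eqP; rewrite eq_le; apply/andP; split.
  by apply: ge_sup => //; exists (Normc.normc (k * g j i)).
by apply: ub_le_sup => //; exists (Normc.normc (k * g j i)).
Qed.

Lemma norm_word_prod i s :
  N (word_prod A (i :: s))
  = path_weight c i s * N (u i *m v (last i s)).
Proof. by rewrite word_prod_rank1 (submult_normZ hN) normc_path_weight. Qed.

(** A rank-one matrix satisfies [W *m W = tr W *: W], and the trace is the closed weight. *)
Lemma word_prod_power s q :
  word_prod A (flatten (nseq q.+1 s)) = closed_weight g s ^+ q *: word_prod A s.
Proof.
elim: q => [|q IH]; first by rewrite /= cats0 expr0 scale1r.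
rewrite -[nseq _ _]/(s :: nseq q.+1 s) /= -/(flatten (nseq q.+1 s)).
rewrite word_prod_cat IH -scalemxAr exprSr -scalerA; congr (_ *: _).
case: s {IH} => [|i s]; first by rewrite /word_prod big_nil mul1mx scale1r.
rewrite word_prod_rank1 -scalemxAl -scalemxAr closed_weight_cons.
rewrite mulmxA -(mulmxA (u i)) mul_row_col mul_mx_scalar -scalemxAl !scalerA.
by congr (_ *: _); rewrite mulrAC.
Qed.

(** Submultiplicativity over consecutive blocks of length [k]. The case [q = 0] is excluded because
    the norm of the identity may exceed 1. *)
Lemma norm_word_prod_le k b : 0 <= b ->
  (forall s, size s = k -> N (word_prod A s) <= b) ->
  forall q s, (0 < q)%N -> size s = (q * k)%N -> N (word_prod A s) <= b ^+ q.
Proof.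
move=> b0 H; elim=> // q IH s _; have [->|q0] := posnP q.
  by rewrite mul1n expr1 => /H.
move=> ss; rewrite -(cat_take_drop k s) word_prod_cat exprS.
apply: (le_trans (submult_normM hN _ _)).
apply: ler_pM; rewrite ?(submult_norm_ge0 hN) //.
  by apply: H; rewrite size_take_min ss mulSn; apply/minn_idPl/leq_addr.
by apply: IH => //; rewrite size_drop ss [in LHS]mulSn addKn.
Qed.

Definition growth k : R :=
  \big[Num.max/0]_(B <- products A k) (N B `^ k%:R^-1).

Lemma growth_ge k s : (0 < k)%N -> size s = k ->
  N (word_prod A s) <= growth k ^+ k.
Proof.
move=> k0 ss; rewrite -powR_invn_le ?(submult_norm_ge0 hN) //; last first.
  exact: bigmax_ge_id.
apply: (@le_bigmax_seq _ _ _ _ 0 (word_prod A s) xpredT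
          (fun B => N B `^ k%:R^-1)) => //.
have /eqP st := ss.
by apply/mapP; exists (Tuple st); rewrite ?mem_enum.
Qed.

Lemma growth_le k b : 0 <= b -> (0 < k)%N ->
  (forall s, size s = k -> N (word_prod A s) <= b ^+ k) -> growth k <= b.
Proof.
move=> b0 k0 H; rewrite /growth big_map; apply: bigmax_le => // s _.
by rewrite powR_invn_le ?(submult_norm_ge0 hN) // H // size_tuple.
Qed.

(** A squeeze: [growth k] is at least [r] for every positive [k], and at most [r + e] for all large
    [k]. *)
Lemma joint_spectral_radius_rank1 r w :
  0 <= r -> (0 < size w)%N -> closed_weight c w = r ^+ size w ->
  (forall s, closed_weight c s <= r ^+ size s) ->
  joint_spectral_radius N A = r.
Proof.
move=> r0 w0 hw hr.
(* Powers of w have norm N(w) r^(k |w|) up to a fixed factor, and cutting them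
   into blocks of length k bounds the same norm by a power of growth k. *)
have lower k : (0 < k)%N -> r <= growth k.
  move=> k0; have growth0 : 0 <= growth k by exact: bigmax_ge_id.
  have [->//|r_neq0] := eqVneq r 0.
  have r_gt0 : 0 < r by rewrite lt_def r_neq0.
  suff : r ^+ (k * size w) <= growth k ^+ (k * size w).
    by rewrite ler_pXn2r ?nnegrE ?muln_gt0 ?k0.
  (* The path weight of [w] divides its closed weight [r ^+ size w], which is nonzero. *)
  have W0 : 0 < N (word_prod A w).
    case: w w0 hw => // i s _ hw; apply: (submult_norm_gt0 hN).
    rewrite word_prod_rank1 scaler_eq0 negb_or outer_neq0 andbT.
    apply/eqP => p0; move: hw; rewrite -normc_closed_weight.
    rewrite closed_weight_cons p0 mul0r Normc.normc0 => /esym/eqP.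
    by rewrite expf_eq0 (negbTE r_neq0) andbF.
  (* Repeating [w] multiplies the norm by [r ^+ size w] for each copy after the first; the quotient
     corrects for the first one. *)
  have d0 : 0 < N (word_prod A w) / r ^+ size w by rewrite divr_gt0 ?exprn_gt0.
  apply: (expr_dominated_le _ d0) => [|q]; first by rewrite exprn_ge0.
  have kq0 : (0 < k * q.+1)%N by rewrite muln_gt0 k0.
  have -> : (r ^+ (k * size w)) ^+ q.+1
            = (r ^+ size w) ^+ (k * q.+1).-1 * r ^+ size w.
    by rewrite -exprSr prednK // -!exprM mulnCA mulnA.
  rewrite [r ^+ size w in leLHS]lock mulrCA divfK -?lock ?expf_neq0 //.
  rewrite -hw -normc_closed_weight -normcX -(submult_normZ hN).
  rewrite -word_prod_power prednK // -exprM -mulnA exprM.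
  apply: norm_word_prod_le; rewrite ?muln_gt0 ?w0 ?exprn_ge0 //.
    by move=> s; apply: growth_ge.
  by rewrite size_flatten /shape map_nseq sumn_nseq; ring.
have upper e : 0 < e -> \forall k \near \oo, growth k <= r + e.
  (* This [s] is positive even when [r = 0], as [open_weight_bound] requires, and is smaller than
     [r + e], so that the powers of [s / (r + e)] absorb the constant [C * D]. *)
  move=> e0; pose s := r + e / 2.
  have s0 : 0 < s by rewrite ltr_wpDl // divr_gt0.
  have re0 : 0 < r + e by rewrite ltr_wpDl.
  have s_lt : 0 <= s / (r + e) < 1.
    rewrite divr_ge0 ?(ltW s0) ?(ltW re0) // ltr_pdivrMr // mul1r ltrD2l.
    by lra.
  have hs v' : closed_weight c v' <= s ^+ size v'.
    apply: (le_trans (hr v')); rewrite lerXn2r ?nnegrE // ?(ltW s0) //.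
    by rewrite lerDl divr_ge0 // ltW.
  have [C C0 hC] := open_weight_bound (fun i j => normc_ge0 _) s0 hs.
  have [D D1 hD] := exists_ubound2 (fun i j => N (u i *m v j)).
  have D0 : 0 < D by exact: lt_le_trans D1.
  have CD0 : 0 < (C * D)^-1 by rewrite invr_gt0 mulr_gt0.
  near=> k.
  have k0 : (0 < k)%N by near: k; exists 1%N.
  apply: growth_le => // [|[|i l] sk]; [exact: ltW|by rewrite -sk in k0|].
  rewrite norm_word_prod.
  apply: (@le_trans _ _ (C * s ^+ k * D)).
    rewrite ler_pM ?path_weight_ge0 ?(submult_norm_ge0 hN) //.
      by move=> *; apply: normc_ge0.
    by have := hC (i :: l); rewrite sk.
  rewrite mulrAC -ler_pdivlMl ?mulr_gt0 // -ler_pdivrMr ?exprn_gt0 //.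
  by rewrite -expr_div_n; near: k; apply: expr_le_near.
apply: cvg_lim => //; apply/cvgrPdist_le => e e0.
near=> k.
have k0 : (0 < k)%N by near: k; exists 1%N.
rewrite distrC ger0_norm ?subr_ge0 ?lower // lerBlDl.
by near: k; apply: upper.
Unshelve. all: by end_near. Qed.

End RankOne.

(** * Finiteness property and minimal maximizing words *)

Theorem theorem3 (R : realType) (n m : nat)
    (N : 'M[R[i]]_n -> R) (hN : submult_norm N)
    (x y : 'I_m -> 'cV[R[i]]_n) (A : 'I_m -> 'M[R[i]]_n)
    (hm : (0 < m)%N)
    (hx : forall i, x i != 0) (hy : forall i, y i != 0)
    (hA : forall i, A i = x i *m (y i)^t*)
    (hinj : injective A)
    (hirr : irreducible_family A) :
  finiteness_property N A /\
  (forall (t : nat) (w : t.-tuple 'I_m),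
     minimal_spectral_maximizing N A w ->
     forall s r : 'I_t, s != r -> tnth w s != tnth w r).
Proof.
pose v i : 'rV[R[i]]_n := (y i)^t*.
have v0 i : v i != 0 by rewrite map_mx_eq0 trmx_eq0.
have defA : A = fun i => x i *m v i by apply/funext.
pose c i j : R := Normc.normc ((v i *m x j) 0 0).
have c0 i j : 0 <= c i j by exact: normc_ge0.
have m0 : (0 < #|'I_m|)%N by rewrite card_ord.
have [r [w0 [r0 w0_gt0 cw0 cw_le]]] := exists_closed_weight_max c0 m0.
have jsr : joint_spectral_radius N A = r.
  by rewrite defA; apply: (joint_spectral_radius_rank1 hN hx v0 r0 w0_gt0).
have smP t (w : t.-tuple 'I_m) :
    spectral_maximizing N A w <-> (0 < t)%N /\ closed_weight c w = r ^+ t.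
  case: t w => [|t] w; first by split; case.
  rewrite /spectral_maximizing jsr defA spectral_radius_word ?size_tuple //.
  have H := powR_invn_eq (closed_weight_ge0 c0 w) r0 (ltn0Sn t).
  by split=> -[_ /H].
split; first by exists (size w0), (in_tuple w0); apply/smP.
move=> t w [/smP [t0 cw] wmin] i j ij; apply: contra_neq ij => wij.
have uw : uniq w.
  apply/negPn/negP => /nuniq_split [p [a [q [u def_w]]]].
  have size_w : t = (size (a :: q) + size (p ++ a :: u))%N.
    by rewrite -[LHS](size_tuple w) def_w size_split.
  have : (size (a :: q) < t)%N by rewrite size_w size_cat /=; lia.
  rewrite ltnNge => /negP; apply.
  (* If [r = 0], no factor can be cancelled, but every closed weight of a single letter vanishes, so
     one letter is already maximizing. *)
  have [r_eq0|r_neq0] := eqVneq r 0.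
    apply: (@leq_trans 1) => //; apply: (wmin 1%N [tuple a]); apply/smP.
    split=> //; apply/eqP; rewrite eq_le (cw_le [:: a]) r_eq0 expr1.
    exact: closed_weight_ge0.
  apply: (wmin _ (in_tuple (a :: q))); apply/smP; split=> //=.
  apply/eqP; rewrite eq_le (cw_le (a :: q)) /=.
  (* The closed weights of [a :: q] and [p ++ a :: u] multiply to [r ^+ t] and each is at most its
     own power of [r]; as these powers are positive, [a :: q] attains its bound. *)
  have rpu : 0 < r ^+ size (p ++ a :: u) by rewrite exprn_gt0 // lt_def r_neq0.
  rewrite -(ler_pM2r rpu) -exprD -[(_ + _)%N]size_w -cw def_w.
  rewrite closed_weight_split ler_wpM2l //; exact: closed_weight_ge0.
exact: (elimT (tuple_uniqP w) uw).
Qed.
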